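(* If $f:\mathbb{R}\to\mathbb{R}$ is globally Lipschitz, then the Cauchy problem for $$\frac{\partial u(x,t)}{\partial t}+u(x,t)=\int_{\mathbb{R}^N}J(x-y)f(u(y,t))\rho(y)\,dy+h(x)$$ is well posed in $C_\rho(\mathbb{R}^N)$, with globally defined solutions.
   Context: Standing assumptions: $N\ge 1$; $J:\mathbb{R}^N\to\mathbb{R}$ is non-negative and integrable; $\rho:\mathbb{R}^N\to\mathbb{R}$ is a symmetric, continuous, positive, bounded weight function with $\int_{\mathbb{R}^N}\rho(x)\,dx<\infty$; $h:\mathbb{R}^N\to\mathbb{R}$ is bounded and continuous. $C_\rho(\mathbb{R}^N)$ is the space of continuous functions $u:\mathbb{R}^N\to\mathbb{R}$ with $\|u\|_\rho:=\sup_{x\in\mathbb{R}^N}|u(x)|\rho(x)<\infty$, normed by $\|\cdot\|_\rho$. The equation is regarded as an ordinary differential equation $\dot u=-u+J*_\rho(f\circ u)+h$ in $C_\rho(\mathbb{R}^N)$, where $(J*_\rho v)(x)=\int_{\mathbb{R}^N}J(x-y)v(y)\rho(y)\,dy$. Well posed with globally defined solutions means: for every $u_0\in C_\rho(\mathbb{R}^N)$ there is a unique continuously differentiable solution $u:[0,\infty)\to C_\rho(\mathbb{R}^N)$ with $u(0)=u_0$, and it depends continuously on $u_0$ (for each fixed time, in the norm $\|\cdot\|_\rho$). *)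

(* Defs.v *)
From HB Require Import structures.
From mathcomp Require Import all_boot all_order all_algebra.
From mathcomp Require Import all_classical all_reals all_analysis.

Set Implicit Arguments.
Unset Strict Implicit.
Unset Printing Implicit Defensive.

Import Order.TTheory GRing.Theory Num.Theory.
Import numFieldNormedType.Exports.

Local Open Scope classical_set_scope.
Local Open Scope ring_scope.

(* Lebesgue measure on R^(n+1): the outer measure is the infimum of the total
   volume of countable covers by closed boxes, and Caratheodory's construction
   turns it into a complete measure on the Lebesgue-measurable sets.  In
   dimension 0 there are no boxes of volume 0, whence 'rV_n.+1. *)
Section lebesgue_outer.
Context {R : realType} {n : nat}.
Local Notation T := 'rV[R]_n.+1.

Definition box (c : T * T) : set T :=
  [set x | forall i, c.1 ord0 i <= x ord0 i <= c.2 ord0 i].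

Definition box_volume (c : T * T) : R :=
  \prod_i Num.max 0 (c.2 ord0 i - c.1 ord0 i).

Local Open Scope ereal_scope.

Definition lebesgue_outer (A : set T) : \bar R :=
  ereal_inf [set \sum_(k <oo) (box_volume (c k))%:E |
             c in [set c : (T * T)^nat | A `<=` \bigcup_k box (c k)]].

Let box_volume_ge0 c : 0 <= (box_volume c)%:E.
Proof. by rewrite lee_fin prodr_ge0// => i _; rewrite le_max lexx. Qed.

Let lebesgue_outer_ge0 A : 0 <= lebesgue_outer A.
Proof. by apply: le_ereal_inf_tmp => _ [c _ <-]; exact: nneseries_ge0. Qed.

Let le_lebesgue_outer : {homo lebesgue_outer : A B / A `<=` B >-> A <= B}.
Proof.
move=> A B AB; apply: ereal_inf_le_tmp => _ [c Bc <-].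
by exists c => //; exact: subset_trans Bc.
Qed.

Let lebesgue_outer0 : lebesgue_outer set0 = 0.
Proof.
apply/eqP; rewrite eq_le lebesgue_outer_ge0 andbT.
apply: ereal_inf_lbound; exists (fun=> (0%R, 0%R)) => //.
apply: eseries0 => k _ _.
by rewrite /box_volume big_ord_recl/= mxE subrr maxxx mul0r.
Qed.

Let lebesgue_outer_sigma_subadditive : sigma_subadditive lebesgue_outer.
Proof.
move=> A; have [[i ioo]|] := pselect (exists i, lebesgue_outer (A i) = +oo).
  rewrite (eseries_pinfty _ _ ioo) ?leey// => k _.
  by rewrite -ltNye (lt_le_trans _ (lebesgue_outer_ge0 _)).
rewrite -forallNE => Aoo.
suff add2e (e : {posnum R}) : lebesgue_outer (\bigcup_n A n) <=
    \sum_(i <oo) lebesgue_outer (A i) + e%:num%:E.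
  by apply/lee_addgt0Pr => _/posnumP[].
rewrite (le_trans _ (epsilon_trick _ _ _))//.
pose P k (c : (T * T)^nat) := A k `<=` \bigcup_j box (c j) /\
  \sum_(j <oo) (box_volume (c j))%:E <=
    lebesgue_outer (A k) + (e%:num / (2 ^ k.+1)%:R)%:E.
have [G PG] : {G : ((T * T)^nat)^nat & forall k, P k (G k)}.
  apply: (@choice _ _ P) => k; rewrite /P /lebesgue_outer.
  set S := (X in ereal_inf X); move infS : (ereal_inf S) => iS.
  case: iS infS => [r Sr|Soo|Soo].
  - have ek : (0 < e%:num / (2 ^ k.+1)%:R)%R by [].
    have /(lb_ereal_inf_adherent ek) : ereal_inf S \is a fin_num by rewrite Sr.
    move=> [x [c Ac <-] xS].
    by exists c; split => //; rewrite -Sr; exact/ltW.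
  - by have := Aoo k; rewrite /lebesgue_outer Soo.
  - by have := lebesgue_outer_ge0 (A k); rewrite /lebesgue_outer Soo.
pose v := fun c => (box_volume c)%:E.
have vG_ge0 x : 0 <= (v \o uncurry G) x by exact: box_volume_ge0.
apply: (@le_trans _ _ (\esum_(i in setT) (v \o uncurry G) i)).
  apply: ereal_inf_lbound => /=.
  have /card_esym/ppcard_eqP[f] := card_nat2.
  exists (uncurry G \o f).
    apply: (@subset_trans _ (\bigcup_k \bigcup_j box (G k j))).
      by move=> t [i _] /(PG i).1 [j _ ?]; exists i => //; exists j.
    by move=> t [i _ [j _ Bij]]; exists (f^-1%FUN (i, j)) => //=; rewrite invK ?inE.
  rewrite -(esum_pred_image (v \o uncurry G) _ xpredT) ?[fun=> _]set_true//.
  by rewrite image_eq.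
rewrite (_ : esum _ _ = \sum_(i <oo) \sum_(j <oo) v (G i j)); last first.
  pose J : nat -> set (nat * nat) := fun i => [set (i, j) | j in setT].
  rewrite (_ : setT = \bigcup_k J k); last first.
    by rewrite predeqE => -[a b]; split => // _; exists a => //; exists b.
  rewrite esum_bigcupT /=; last 2 first.
    - apply/trivIsetP => i j _ _ ij.
      rewrite predeqE => -[k m] /=; split => //= -[] [_] _ [<-{k} _].
      by move=> [m' _] [] /esym/eqP; rewrite (negbTE ij).
    - by move=> /= [k m]; exact: box_volume_ge0.
  rewrite -(image_id [set: nat]) -fun_true esum_pred_image//; last first.
    by move=> k _; apply: esum_ge0 => m _; exact: box_volume_ge0.
  apply: eq_eseriesr => /= j _.
  rewrite -(esum_pred_image (v \o uncurry G) (pair j) predT)//=; last first.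
    by move=> ? ? _ _; exact: (@can_inj _ _ _ snd).
    by move=> k _; exact: box_volume_ge0.
  by congr esum; rewrite predeqE => -[a b]; split; move=> [i _ <-]; exists i.
apply: lee_lim.
- apply: is_cvg_nneseries => k _ _.
  by apply: nneseries_ge0 => m _ _; exact: (vG_ge0 (k, m)).
- by apply: is_cvg_nneseries => k _ _; apply: adde_ge0.
- by apply: nearW => k; apply: lee_sum => i _; exact: (PG i).2.
Qed.

HB.instance Definition _ := isOuterMeasure.Build R T lebesgue_outer
  lebesgue_outer0 lebesgue_outer_ge0 le_lebesgue_outer
  lebesgue_outer_sigma_subadditive.

End lebesgue_outer.

Definition lebesgue_type (R : realType) (n : nat) : measurableType _ :=
  caratheodory_type (@lebesgue_outer R n).

Definition lebesgue_measure_rV (R : realType) (n : nat) :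
    set (lebesgue_type R n) -> \bar R :=
  @lebesgue_outer R n.

HB.instance Definition _ (R : realType) (n : nat) :=
  isMeasure.Build _ _ _ (@lebesgue_measure_rV R n)
    (@caratheodory_measure0 _ _ (@lebesgue_outer R n))
    (@caratheodory_measure_ge0 _ _ (@lebesgue_outer R n))
    (@caratheodory_measure_sigma_additive _ _ (@lebesgue_outer R n)).

Arguments lebesgue_measure_rV : clear implicits.

(* Positivity of the weight is a parameter of the space because it is what
   makes the weighted norm separated. *)
Section weighted_space.
Context {R : realType} {n : nat} {rho : 'rV[R]_n.+1 -> R}.
Local Notation T := 'rV[R]_n.+1.

Definition in_weighted_space (rho_gt0 : forall x, 0 < rho x) : {pred T -> R} :=
  fun u => `[< continuous u /\ has_ubound (range (fun x => `|u x| * rho x)) >].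

Record weighted_space (rho_gt0 : forall x, 0 < rho x) := WeightedSpace {
  weighted_fun :> T -> R;
  _ : weighted_fun \in in_weighted_space rho_gt0 }.

Variable rho_gt0 : forall x, 0 < rho x.
Local Notation C_rho := (weighted_space rho_gt0).

HB.instance Definition _ := [isSub for @weighted_fun rho_gt0].
HB.instance Definition _ := [Choice of C_rho by <:].

Let rho_ge0 x : 0 <= rho x.
Proof. exact/ltW. Qed.

Let in_weighted_space_submod_closed :
  submod_closed (in_weighted_space rho_gt0).
Proof.
split.
  apply/asboolP; split; first by apply: cst_continuous.
  by exists 0 => _ [x _ <-]; rewrite normr0 mul0r.
move=> a u v /asboolP[cu [M uM]] /asboolP[cv [N vN]]; apply/asboolP; split.
  move=> x; suff: (a *: u + v) @ x --> (a * u x + v x) by [].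
  exact: (cvgD (cvgM (cvg_cst a) (cu x)) (cv x)).
exists (`|a| * M + N) => _ [x _ <-] /=.
rewrite (@le_trans _ _ ((`|a| * `|u x| + `|v x|) * rho x))//.
  by rewrite ler_wpM2r// (le_trans (ler_normD _ _))// normrM.
rewrite mulrDl -mulrA lerD//; last by apply: vN; exists x.
by rewrite ler_wpM2l//; apply: uM; exists x.
Qed.

HB.instance Definition _ := GRing.isSubmodClosed.Build R (T -> R)
  (in_weighted_space rho_gt0) in_weighted_space_submod_closed.
HB.instance Definition _ := [SubChoice_isSubLmodule of C_rho by <:].

Definition weighted_norm (u : C_rho) : R :=
  sup (range (fun x => `|u x| * rho x)).

Lemma weighted_norm_ub (u : C_rho) x : `|u x| * rho x <= weighted_norm u.
Proof.
apply: ub_le_sup; last by exists x.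
by have /asboolP[] := valP u.
Qed.

Lemma weighted_norm_le (u : C_rho) M :
  (forall x, `|u x| * rho x <= M) -> weighted_norm u <= M.
Proof.
move=> uM; apply: ge_sup; first by exists (`|u 0| * rho 0); exists 0.
by move=> _ [x _ <-].
Qed.

Let weighted_normD (u v : C_rho) :
  weighted_norm (u + v) <= weighted_norm u + weighted_norm v.
Proof.
apply: weighted_norm_le => x.
rewrite (@le_trans _ _ ((`|u x| + `|v x|) * rho x))//.
  by rewrite ler_wpM2r// ler_normD.
by rewrite mulrDl lerD ?weighted_norm_ub.
Qed.

Let weighted_normZ (a : R) (u : C_rho) :
  weighted_norm (a *: u) = `|a| * weighted_norm u.
Proof.
have le b (w : C_rho) : weighted_norm (b *: w) <= `|b| * weighted_norm w.
  apply: weighted_norm_le => x; rewrite -[X in X <= _]/(`|b * w x| * rho x).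
  by rewrite normrM -mulrA ler_wpM2l ?weighted_norm_ub.
apply/eqP; rewrite eq_le le/=.
have [->|a0] := eqVneq a 0.
  rewrite normr0 mul0r (le_trans _ (weighted_norm_ub _ 0))//.
  by rewrite mulr_ge0.
rewrite -ler_pdivlMl ?normr_gt0//.
by have := le a^-1 (a *: u); rewrite scalerA mulVf// scale1r normfV.
Qed.

Let weighted_norm0_eq0 (u : C_rho) : weighted_norm u = 0 -> u = 0.
Proof.
move=> u0; apply/val_inj/funext => x; apply/eqP; rewrite -normr_le0.
by have := weighted_norm_ub u x; rewrite u0 pmulr_lle0.
Qed.

HB.instance Definition _ := Lmodule_isNormed.Build R C_rho
  weighted_normD weighted_normZ weighted_norm0_eq0.

End weighted_space.

Section ode.
Context {R : realType} {V : normedModType R}.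

(* Derivative at t relative to [0, +oo[, hence one-sided at t = 0. *)
Definition is_derive_ge0 (u : R -> V) (t : R) (v : V) : Prop :=
  (fun s => s^-1 *: (u (t + s) - u t)) @
    within [set s | 0 <= t + s] 0^' --> v.

(* Only the values of u on [0, +oo[ are relevant. *)
Definition is_C1_solution (F : V -> V) (u0 : V) (u : R -> V) : Prop :=
  exists u' : R -> V,
    [/\ u 0 = u0,
        forall t, 0 <= t -> is_derive_ge0 u t (u' t),
        {within `[0, +oo[, continuous u'} &
        forall t, 0 <= t -> u' t = F (u t)].

Definition globally_well_posed (F : V -> V) : Prop :=
  exists S : R -> V -> V,
    [/\ forall u0, is_C1_solution F u0 (S ^~ u0),
        forall u0 u, is_C1_solution F u0 u ->
          forall t, 0 <= t -> u t = S t u0 &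
        forall t, 0 <= t -> continuous (S t)].

End ode.

Section weighted_convolution.
Context {R : realType} {n : nat}.
Local Notation T := 'rV[R]_n.+1.

Definition wconv_integrand (J rho v : T -> R) (x y : T) : R :=
  J (x - y) * v y * rho y.

Definition wconv (J rho v : T -> R) (x : T) : R :=
  \int[lebesgue_measure_rV R n]_y wconv_integrand J rho v x y.

End weighted_convolution.

(* Main.v *)
From HB Require Import structures.
Require Import Defs.
From mathcomp Require Import all_boot all_order all_algebra.
From mathcomp Require Import all_classical all_reals all_analysis.
From mathcomp Require Import measurable_realfun ring lra.
Import Order.TTheory GRing.Theory Num.Theory.
Import numFieldNormedType.Exports.
Local Open Scope classical_set_scope.
Local Open Scope ring_scope.

(* For u in C_rho the function (f o u) rho is continuous and bounded, so its
   convolution with the integrable kernel J is continuous and bounded, hence in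
   C_rho because rho is bounded.  Continuity follows by moving the translation
   from J to the continuous factor (Lebesgue measure is invariant under
   y |-> x - y) and dominating by a multiple of J.  The right-hand side is
   therefore a globally Lipschitz vector field on the Banach space C_rho.

   For a K-Lipschitz field F on a Banach space no vector-valued integral is
   needed: the Euler polygons with mesh 2^-m converge, and the estimate
     |x_j - x_0 - (j d) F(x_0)| <= K (j d)^2 exp(K j d) |F(x_0)|
   is uniform in the step d, so the limit u satisfies
     u(s) - u(t) - (s - t) F(u(t)) = O((s - t)^2)
   locally uniformly, which is differentiability with u' = F(u).  Uniqueness is
   a Gronwall argument on the norm of the difference of two solutions. *)

(** * Lebesgue measure on R^(n+1) *)

Section euclidean_lebesgue.
Context {R : realType} {n : nat}.
Local Notation T := 'rV[R]_n.+1.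
Local Notation L := (lebesgue_type R n).
Local Notation mu := (lebesgue_measure_rV R n).
Implicit Types (A : set T) (c : T * T).

Lemma box_volume_ge0 c : (0 <= (box_volume c)%:E)%E.
Proof. by rewrite lee_fin prodr_ge0// => i _; rewrite le_max lexx. Qed.

Lemma lebesgue_outer_le A (c : (T * T)^nat) :
  A `<=` \bigcup_k box (c k) ->
  (lebesgue_outer A <= \sum_(k <oo) (box_volume (c k))%:E)%E.
Proof. by move=> Ac; apply: ereal_inf_lbound; exists c. Qed.

(* The hyperplane x_i = a cuts a box into two boxes whose volumes add up to the
   original one; this is what makes half-spaces Caratheodory-measurable. *)
Definition box_below (i : 'I_n.+1) (a : R) c : T * T :=
  (c.1, \row_j if j == i then Num.min a (c.2 ord0 j) else c.2 ord0 j).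

Definition box_above (i : 'I_n.+1) (a : R) c : T * T :=
  (\row_j (if j == i then Num.max a (c.1 ord0 j) else c.1 ord0 j), c.2).

Lemma box_volume_split i a c :
  box_volume (box_below i a c) + box_volume (box_above i a c) = box_volume c.
Proof.
have D1 d : box_volume d = Num.max 0 (d.2 ord0 i - d.1 ord0 i) *
    \prod_(j < n.+1 | j != i) Num.max 0 (d.2 ord0 j - d.1 ord0 j).
  by rewrite /box_volume (bigD1 i).
rewrite !D1 /= !mxE eqxx.
have -> : \prod_(j < n.+1 | j != i)
    Num.max 0 ((box_below i a c).2 ord0 j - c.1 ord0 j) =
    \prod_(j < n.+1 | j != i) Num.max 0 (c.2 ord0 j - c.1 ord0 j).
  by apply: eq_bigr => j ji; rewrite !mxE (negbTE ji).
have -> : \prod_(j < n.+1 | j != i)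
    Num.max 0 (c.2 ord0 j - (box_above i a c).1 ord0 j) =
    \prod_(j < n.+1 | j != i) Num.max 0 (c.2 ord0 j - c.1 ord0 j).
  by apply: eq_bigr => j ji; rewrite !mxE (negbTE ji).
rewrite -mulrDl; congr (_ * _).
move: (c.1 _ _) (c.2 _ _) => l u; rewrite !maxEle !minEle.
by case: (leP a u) => ?; case: (leP a l) => ?; do ![case: leP => ?]; lra.
Qed.

(** Only superadditivity on a test set [X] has to be checked. Cutting every box of a cover of [X]
    yields covers of the two pieces of [X], with no change in total volume. *)
Lemma measurable_half_space (i : 'I_n.+1) (a : R) :
  measurable ([set x | x ord0 i <= a] : set L).
Proof.
apply: le_caratheodory_measurable => X; apply: le_ereal_inf_tmp => _ [c Xc <-].
under eq_eseriesr do rewrite -(box_volume_split i a) EFinD.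
rewrite nneseriesD; [|by move=> *; exact: box_volume_ge0..].
apply: leeD; apply: lebesgue_outer_le => x [/Xc[k _ xk] /= xa]; exists k => // j.
  rewrite /= mxE; case: eqP => [->|_]; last exact: xk.
  by rewrite le_min xa andbA andbAC; have /andP[-> ->] := xk i.
rewrite /= mxE; case: eqP => [->|_]; last exact: xk.
by rewrite ge_max -andbA ltW ?ltNge; [exact: xk|exact/negP].
Qed.

(** An open set is the union of the half-open cells with rational corners that it contains, and each
    cell is a finite intersection of differences of half-spaces. *)
Lemma open_measurable_lebesgue A : open A -> measurable (A : set L).
Proof.
move=> oA.
pose slab (i : 'I_n.+1) (p q : rat) : set L :=
  [set x | x ord0 i <= ratr q] `\` [set x | x ord0 i <= ratr p].
pose cell (w : {ffun 'I_n.+1 -> rat * rat}) : set L :=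
  \bigcap_(i in [set: 'I_n.+1]) slab i (w i).1 (w i).2.
have mcell w : measurable (cell w).
  apply: fin_bigcap_measurable => // i _.
  by apply: measurableD; exact: measurable_half_space.
(* Cells that leave [A] are replaced by the empty set, so that the union runs over a whole countable
   type. *)
pose F w := if `[< cell w `<=` A >] then cell w else set0.
have -> : A = \bigcup_w F w; last first.
  apply: countable_bigcupT_measurable => // w.
  by rewrite /F; case: ifPn => // _; exact: measurable0.
apply/seteqP; split=> [x Ax|x [w _]]; last first.
  by rewrite /F; case: ifPn => [/asboolP cA /cA|].
have /nbhs_ballP[e /= e0 eA] : nbhs x A by exact: open_nbhs_nbhs.
have bet i : exists pq : rat * rat,
    x ord0 i - e < ratr pq.1 < x ord0 i /\ x ord0 i < ratr pq.2 < x ord0 i + e.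
  have /rat_in_itvoo[p] : x ord0 i - e < x ord0 i by lra.
  have /rat_in_itvoo[q] : x ord0 i < x ord0 i + e by lra.
  by rewrite !in_itv/= => xq px; exists (p, q).
have [f fP] := choice bet.
have fx y : cell [ffun i => f i] y <->
    forall i, ratr (f i).1 < y ord0 i <= ratr (f i).2.
  split=> [yc i|yc i _].
    have [/=] := yc i I; rewrite !ffunE => -> /negP; rewrite -ltNge => ->.
    by [].
  rewrite /slab !ffunE /=; have /andP[] := yc i; rewrite ltNge => /negP.
  by [].
exists [ffun i => f i] => //; rewrite /F asboolT.
  apply/fx => i; have [/andP[_ ->] /andP[/ltW -> _]] := fP i.
  by [].
move=> y /fx yf; apply: eA; split=> // i j; rewrite ord1 -ball_normE /=.
have [/andP[? ?] /andP[? ?]] := fP j; have /andP[? ?] := yf j.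
by rewrite ltr_distl; apply/andP; split; lra.
Qed.

Lemma continuous_measurable_lebesgue (g : T -> R) :
  continuous g -> measurable_fun [set: L] (g : L -> R).
Proof.
move=> /continuousP cg.
apply: (measurability _ (measurable_realfun.RGenOInfty.measurableE R)).
move=> _ [_ [x ->] <-]; rewrite setTI; apply: open_measurable_lebesgue.
exact/cg/interval_open.
Qed.

Definition reflection (x : T) : L -> L := fun y => (x - y : T).

Lemma reflectK x : involutive (reflection x).
Proof. by move=> y; rewrite /reflection opprB addrC subrK. Qed.

Lemma preimage_reflectK x A : reflection x @^-1` (reflection x @^-1` A) = A.
Proof. by apply/seteqP; split=> y; rewrite /preimage/= reflectK. Qed.

(** A reflected cover consists of boxes of the same volume with their corners exchanged, which gives
    one inequality. The other follows by applying it to the preimage, the reflection being an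
    involution. *)
Lemma lebesgue_outer_reflect x A :
  lebesgue_outer (reflection x @^-1` A) = lebesgue_outer A.
Proof.
have le B : (lebesgue_outer (reflection x @^-1` B) <= lebesgue_outer B)%E.
  apply: le_ereal_inf_tmp => _ [c Bc <-].
  pose c' k := (reflection x (c k).2, reflection x (c k).1).
  rewrite (eq_eseriesr (g := fun k => (box_volume (c' k))%:E)); last first.
    move=> k _; congr EFin; apply: eq_bigr => i _; rewrite !mxE.
    by congr Num.max; ring.
  apply: lebesgue_outer_le => y /Bc[k _ yk]; exists k => // i.
  by have := yk i; rewrite !mxE; lra.
by apply/eqP; rewrite eq_le le/= -{1}(preimage_reflectK x A) le.
Qed.

(** Continuity would not suffice, since all Caratheodory sets are measurable here. Caratheodory's
    condition involves only the outer measure, which the reflection preserves, so [B] is tested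
    against the reflected [X]. *)
Lemma measurable_reflect x : measurable_fun [set: L] (reflection x).
Proof.
move=> _ B mB; rewrite setTI.
suff: (@lebesgue_outer R n).-caratheodory (reflection x @^-1` B) by [].
move=> X; have {}mB : (@lebesgue_outer R n).-caratheodory B by [].
rewrite -(lebesgue_outer_reflect x X) mB.
rewrite -(lebesgue_outer_reflect x (_ `&` B)).
rewrite -(lebesgue_outer_reflect x (_ `&` ~` B)).
by rewrite !preimage_setI preimage_reflectK preimage_setC.
Qed.

Lemma pushforward_reflect x : pushforward mu (reflection x) = mu.
Proof. by apply/funext => A; exact: lebesgue_outer_reflect. Qed.

Lemma integrable_reflect x (g : L -> \bar R) :
  mu.-integrable setT g -> mu.-integrable setT (g \o (reflection x)).
Proof.
move=> /integrableP[mg ig].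
have mgr : measurable_fun [set: L] (g \o (reflection x)).
  exact: (measurableT_comp mg (measurable_reflect x)).
apply/integrableP; split => //.
suff <- : (\int[pushforward mu (reflection x)]_y `|g y| =
    \int[mu]_y `|(g \o reflection x) y|)%E by rewrite pushforward_reflect.
apply: ge0_integral_pushforward => //; first exact: measurable_reflect.
exact: measurableT_comp.
Qed.

Lemma integral_reflect x (g : L -> \bar R) : mu.-integrable setT g ->
  (\int[mu]_y g (reflection x y) = \int[mu]_y g y)%E.
Proof.
move=> ig; rewrite -[RHS](congr1 (fun m => \int[m]_y g y)%E (pushforward_reflect x)).
rewrite integral_pushforward//; first exact: measurable_reflect.
  exact: measurable_int ig.
exact: integrable_reflect.
Qed.

End euclidean_lebesgue.

(** * Convolution *)

(** If convergence fails, the balls of radius 1/(k+1) supply a sequence that contradicts the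
    hypothesis. This reduces continuity of the convolution to dominated convergence along
    sequences. *)
Lemma cvg_at_seq {R : realType} {U V : pseudoMetricType R} (f : U -> V) (p : U) (l : V) :
  (forall u : U^nat, u @ \oo --> p -> f \o u @ \oo --> l) ->
  f @ p --> l.
Proof.
move=> seqf; apply/cvg_ballP => e e0; apply: contrapT => nf.
have bad k : exists u, ball p k.+1%:R^-1 u /\ ~ ball l e (f u).
  apply: contrapT => /forallNP good; apply: nf.
  have : \forall u \near p, ball p k.+1%:R^-1 u by apply: nbhsx_ballx; rewrite invr_gt0.
  apply: filterS => u pu; apply: contrapT => nu; exact: (good u).
have [u uP] := choice bad.
have up : u @ \oo --> p.
  apply/cvg_ballP => d d0; near=> k.
  apply: le_ball (uP k).1; apply/ltW; near: k.
  exact: near_infty_natSinv_lt (PosNum d0).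
have /cvg_ballP/(_ _ e0)[N _ /(_ N (leqnn N))] := seqf _ up.
exact: (uP N).2.
Unshelve. all: by end_near. Qed.

Section convolution.
Context {R : realType} {n : nat}.
Local Notation T := 'rV[R]_n.+1.
Local Notation L := (lebesgue_type R n).
Local Notation mu := (lebesgue_measure_rV R n).
Variables (J g : T -> R) (M : R).
Hypotheses (J_ge0 : forall x, 0 <= J x)
  (J_int : mu.-integrable setT (EFin \o J)).
Hypotheses (g_cont : continuous g) (g_le : forall x, `|g x| <= M).

Let measurable_J : measurable_fun [set: L] (J : L -> R).
Proof. exact/measurable_EFinP/(measurable_int _ J_int). Qed.

Lemma continuous_reflection (x : T) : continuous (reflection x : T -> T).
Proof.
move=> y; suff: (fun z : T => x - z) @ y --> x - y by [].
exact: (@cvgB _ _ _ (nbhs y) _ (fun=> x) id x y (cvg_cst x) cvg_id).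
Qed.

Lemma integrable_mul_bounded {k : T -> R} : continuous k ->
  (forall x, `|k x| <= M) ->
  mu.-integrable setT (EFin \o ((fun y => J y * k y) : L -> R)).
Proof.
move=> ck kM.
apply: (@le_integrable _ _ _ mu _ measurableT _ (fun y : L => (M * J y)%:E)).
- apply/measurable_EFinP; apply: measurable_funM => //.
  exact: continuous_measurable_lebesgue.
- move=> y _; rewrite /= lee_fin !normrM mulrC ler_wpM2r//.
  by rewrite (le_trans (kM y))// ler_norm.
- exact: (@integrableZl _ _ _ mu _ measurableT M _ J_int).
Qed.

Let reflected x : continuous (g \o reflection x).
Proof. by move=> y; apply: continuous_comp; [exact: continuous_reflection|exact: g_cont]. Qed.

Lemma convolution_integrable (x : T) :
  mu.-integrable setT (EFin \o ((fun y => J (x - y) * g y) : L -> R)).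
Proof.
have := @integrable_reflect _ _ x _
  (integrable_mul_bounded (reflected x) (fun y => g_le _)).
congr (integrable _ _ _); apply/funext => y /=; congr EFin.
by rewrite /= (reflectK x y).
Qed.

Lemma convolution_reflect (x : T) :
  \int[mu]_y (J (x - y) * g y) = \int[mu]_y (J y * g (x - y)).
Proof.
rewrite /Rintegral -(integral_reflect x); last exact: convolution_integrable.
congr fine; apply: eq_integral => y _ /=; congr EFin.
by rewrite -[x - (x - y)]/(reflection x (reflection x y)) reflectK.
Qed.

Lemma convolution_continuous :
  continuous (fun x : T => \int[mu]_y (J (x - y) * g y) : R).
Proof.
move=> p; rewrite (_ : (fun x => _) = fun x => \int[mu]_y (J y * g (x - y))); last first.
  by apply/funext => x; exact: convolution_reflect.
apply: cvg_at_seq => u up; apply: fine_cvg.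
rewrite fineK; last first.
  exact: integrable_fin_num (integrable_mul_bounded (reflected p) (fun y => g_le _)).
apply: (@dominated_cvg _ _ _ mu setT measurableT
  (fun k (y : L) => (J y * g (u k - y))%:E) _ (fun y : L => (M * J y)%:E)) => //.
- move=> k; have := integrable_mul_bounded (reflected (u k)) (fun y => g_le _).
  exact: measurable_int.
- move=> y _; apply: cvg_EFin; first exact: nearW.
  apply: (cvgM (cvg_cst (J y))).
  apply: (@cvg_comp _ _ _ _ g); last exact: g_cont.
  exact: (cvgB up (cvg_cst y)).
- exact: (@integrableZl _ _ _ mu _ measurableT M _ J_int).
- move=> k y _; rewrite lee_fin normrM (ger0_norm (J_ge0 y)) mulrC.
  by rewrite ler_wpM2r.
Qed.

Lemma convolution_le (x : T) :
  `|\int[mu]_y (J (x - y) * g y)| <= M * \int[mu]_y J y.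
Proof.
rewrite convolution_reflect (le_trans (le_normr_Rintegral _ _))//.
  exact: integrable_mul_bounded (reflected x) (fun y => g_le _).
rewrite -RintegralZl//; apply: le_Rintegral => //.
- apply: (@eq_integrable _ _ _ mu setT measurableT (abse \o (EFin \o _))); last first.
    exact: integrable_abse (integrable_mul_bounded (reflected x) (fun y => g_le _)).
  by [].
- exact: (@integrableZl _ _ _ mu _ measurableT M _ J_int).
- by move=> y _; rewrite normrM (ger0_norm (J_ge0 y)) mulrC ler_wpM2r.
Qed.

End convolution.

(** * Completeness of the weighted space *)

Section weighted_space_complete.
Context {R : realType} {n : nat} {rho : 'rV[R]_n.+1 -> R}.
Variables (rho_gt0 : forall x, 0 < rho x) (rho_cont : continuous rho).
Local Notation T := 'rV[R]_n.+1.
Local Notation C_rho := (weighted_space rho_gt0).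

Lemma continuous_weighted (u : C_rho) : continuous (u : T -> R).
Proof. by have /asboolP[] := valP u. Qed.

(** Near [p] the weight exceeds [rho p / 2], so weighted approximation is locally uniform
    approximation there and the usual argument with three errors [e / 3] applies. *)
Lemma uniform_weighted_limit_continuous (g : T -> R) :
  (forall e, 0 < e -> exists u : C_rho, forall x, `|g x - u x| * rho x <= e) ->
  continuous g.
Proof.
move=> ug p; apply/(@cvgrPdist_le _ _ _ _ (nbhs_filter (p : T))) => e e0.
have [|u gu] := ug (e / 3 * (rho p / 2)); first by rewrite !(mulr_gt0, divr_gt0).
have gu_le x : rho p / 2 < rho x -> `|g x - u x| <= e / 3.
  move=> px; rewrite -(ler_pM2r (rho_gt0 x)) (le_trans (gu x))//.
  by rewrite ler_wpM2l// ?ltW// divr_gt0.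
near=> x.
have px : rho p / 2 < rho x.
  near: x; have /(@cvgr_gt _ _ _ (nbhs_filter (p : T))) := rho_cont p; apply.
  by have := rho_gt0 p; lra.
have ux : `|u p - u x| <= e / 3.
  near: x; have /(@cvgrPdist_le _ _ _ _ (nbhs_filter (p : T))) := @continuous_weighted u p; apply.
  by rewrite divr_gt0.
have pp : rho p / 2 < rho p by have := rho_gt0 p; lra.
have := gu_le _ px; have := gu_le _ pp; move: ux.
by rewrite !ler_norml => /andP[? ?] /andP[? ?] /andP[? ?]; apply/andP; split; lra.
Unshelve. all: by end_near. Qed.

(** Evaluation at each point is continuous because the weight is positive, so a Cauchy filter has a
    pointwise limit [g]; the Cauchy bound makes the convergence uniform in the weighted sense. *)
Lemma weighted_space_complete (F : set_system C_rho) :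
  ProperFilter F -> cauchy F -> cvg F.
Proof.
move=> FF /cauchy_ballP Fc.
have Fc2 e : 0 < e -> \forall u & v \near F, `|u - v| < e.
  by move=> /Fc; rewrite -ball_normE.
have le_norm (u v : C_rho) x : `|u x - v x| * rho x <= `|u - v|.
  exact: (weighted_norm_ub (u - v) x).
have evF x : (fun u : C_rho => u x) @ F --> lim ((fun u : C_rho => u x) @ F).
  apply: cauchy_cvg; apply/cauchy_ballP => e e0.
  have er : 0 < e * rho x by rewrite mulr_gt0.
  rewrite near_map2; have := Fc2 _ er.
  apply: filterS => -[u v] /= uv; rewrite -ball_normE /=.
  by rewrite -(ltr_pM2r (rho_gt0 x)) (le_lt_trans (le_norm u v x)).
pose g x := lim ((fun u : C_rho => u x) @ F).
have Fg e : 0 < e -> \forall u \near F, forall x, `|g x - (u : C_rho) x| * rho x <= e.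
  (* With [u] fixed, [v] runs along the filter; the bound [e] does not depend on [x]. *)
  move=> /Fc2/nearP_dep; apply: filterS => u Fu x.
  have h : (fun v : C_rho => `|v x - u x| * rho x) @ F --> `|g x - u x| * rho x.
    exact: (cvgM (cvg_norm (cvgB (evF x) (cvg_cst (u x)))) (cvg_cst (rho x))).
  apply: (cvgr_to_le h).
  by apply: filterS Fu => v /ltW uv; rewrite (le_trans (le_norm v u x))// distrC.
have cg : continuous g.
  apply: uniform_weighted_limit_continuous => e /Fg/filter_ex[u gu].
  by exists u.
have gW : g \in in_weighted_space rho_gt0.
  apply/asboolP; split => //.
  have /filter_ex[u gu] := Fg _ ltr01.
  exists (1 + `|u|) => _ [x _ <-].
  rewrite (le_trans _ (lerD (gu x) (weighted_norm_ub u x)))//.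
  by rewrite -mulrDl ler_wpM2r ?(ltW (rho_gt0 x))// -[X in `|X|](subrK (u x)) ler_normD.
apply/cvg_ex; exists (WeightedSpace gW : C_rho); apply/cvgrPdist_le => e /Fg.
by apply: filterS => u gu; apply: weighted_norm_le => x; exact: gu.
Qed.

End weighted_space_complete.

(** * Lipschitz vector fields on Banach spaces *)

Section euler_scheme.
Context {R : realType} {V : normedModType R}.
Variables (F : V -> V) (K : R).
Hypotheses (K_ge0 : 0 <= K) (F_lip : forall u v, `|F u - F v| <= K * `|u - v|).
Implicit Types (d : R) (j k : nat) (u v : V).

Definition euler d k u := iter k (fun v => v + d *: F v) u.

(** An upper bound for (1 + K d)^k, the Lipschitz constant of [k] Euler steps. The exponential form
    is multiplicative in [k] and depends only on the elapsed time k d, hence is unchanged when steps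
    are halved. *)
Definition growth d k := expR (K * (k%:R * d)).

Lemma eulerS d k u : euler d k.+1 u = euler d k u + d *: F (euler d k u).
Proof. by []. Qed.

Lemma eulerD d j k u : euler d (j + k) u = euler d j (euler d k u).
Proof. exact: iterD. Qed.

Lemma growth_ge0 d k : 0 <= growth d k.
Proof. exact: expR_ge0. Qed.

Lemma growthD d j k : growth d (j + k) = growth d j * growth d k.
Proof. by rewrite /growth natrD mulrDl mulrDr expRD. Qed.

Lemma growth1_ge d : 1 + K * d <= growth d 1.
Proof. by rewrite /growth mul1r expR_ge1Dx. Qed.

Lemma growth_mono d j k : 0 <= d -> (j <= k)%N -> growth d j <= growth d k.
Proof. by move=> d0 jk; rewrite ler_expR !(ler_wpM2l, ler_wpM2r)// ler_nat. Qed.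

Lemma euler_lip d k u v : 0 <= d ->
  `|euler d k u - euler d k v| <= growth d k * `|u - v|.
Proof.
move=> d0; elim: k => [|k ih]; first by rewrite /growth mul0r mulr0 expR0 mul1r.
rewrite !eulerS opprD addrACA -scalerBr (le_trans (ler_normD _ _))//.
rewrite normrZ (ger0_norm d0) -add1n growthD -mulrA.
rewrite (@le_trans _ _ ((1 + K * d) * `|euler d k u - euler d k v|))//.
  by rewrite mulrDl mul1r lerD2l (le_trans (ler_wpM2l d0 (F_lip _ _)))// mulrCA mulrA.
rewrite (le_trans (ler_wpM2r _ (growth1_ge d)))//.
by rewrite ler_wpM2l ?growth_ge0.
Qed.

(** One step moves the point by d |F|, so it changes [F] by at most K d |F| and multiplies its norm
    by at most 1 + K d. *)
Lemma euler_field_le d k u : 0 <= d ->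
  `|F (euler d k u)| <= growth d k * `|F u|.
Proof.
move=> d0; elim: k => [|k ih]; first by rewrite /growth mul0r mulr0 expR0 mul1r.
rewrite eulerS -add1n growthD -mulrA.
rewrite -[F (_ + _)](subrK (F (euler d k u))) (le_trans (ler_normD _ _))//.
rewrite (@le_trans _ _ ((1 + K * d) * `|F (euler d k u)|))//.
  rewrite mulrDl mul1r addrC lerD2l (le_trans (F_lip _ _))//.
  by rewrite addrAC subrr add0r normrZ (ger0_norm d0) mulrA.
rewrite (le_trans (ler_wpM2r _ (growth1_ge d)))//.
by rewrite ler_wpM2l ?growth_ge0.
Qed.

Lemma euler_dist_le d j u : 0 <= d ->
  `|euler d j u - u| <= j%:R * d * (growth d j * `|F u|).
Proof.
move=> d0; elim: j => [|j ih]; first by rewrite subrr normr0 !mul0r.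
rewrite eulerS addrAC (le_trans (ler_normD _ _))//.
rewrite normrZ (ger0_norm d0).
rewrite (@le_trans _ _ (j.+1%:R * d * (growth d j * `|F u|)))//.
  rewrite -natr1 !mulrDl mul1r lerD//.
  by rewrite ler_wpM2l ?euler_field_le.
by rewrite ler_wpM2l ?mulr_ge0// ler_wpM2r ?growth_mono.
Qed.

(** Each further step adds the defect d (F(x_j) - F(x_0)), which [euler_dist_le] and the Lipschitz
    condition bound; the sum of these defects is quadratic in the elapsed time. *)
Lemma euler_quadratic d j u : 0 <= d ->
  `|euler d j u - u - (j%:R * d) *: F u| <=
  K * (j%:R * d) ^+ 2 * (growth d j * `|F u|).
Proof.
move=> d0; elim: j => [|j ih].
  by rewrite !mul0r scale0r subrr subr0 normr0 expr0n/= mulr0 mul0r.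
have -> : euler d j.+1 u - u - (j.+1%:R * d) *: F u =
    (euler d j u - u - (j%:R * d) *: F u) + d *: (F (euler d j u) - F u).
  rewrite eulerS -natr1 mulrDl mul1r scalerDl scalerBr opprD.
  by rewrite [_ + _ - u]addrAC addrACA.
rewrite (le_trans (ler_normD _ _))// normrZ (ger0_norm d0).
have step : d * `|F (euler d j u) - F u| <=
    d * (K * (j%:R * d * (growth d j * `|F u|))).
  by rewrite ler_wpM2l// (le_trans (F_lip _ _))// ler_wpM2l// euler_dist_le.
rewrite (le_trans (lerD ih step))//.
rewrite (@le_trans _ _ (K * (j.+1%:R * d) ^+ 2 * (growth d j * `|F u|)))//.
  have -> : K * (j%:R * d) ^+ 2 * (growth d j * `|F u|) +
    d * (K * (j%:R * d * (growth d j * `|F u|))) =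
    (K * ((j%:R ^+ 2 + j%:R) * d ^+ 2)) * (growth d j * `|F u|) by ring.
  rewrite ler_wpM2r ?mulr_ge0 ?growth_ge0// ler_wpM2l// exprMn.
  by rewrite ler_wpM2r ?sqr_ge0// -natr1; have := ler0n R j; nra.
rewrite ler_wpM2l ?mulr_ge0 ?sqr_ge0//.
by rewrite ler_wpM2r// growth_mono.
Qed.

(* Two steps of length d / 2 against one step of length d: the local error is the
   case j = 2 of [euler_quadratic]. *)
Lemma euler_halve d k u : 0 <= d ->
  `|euler (d / 2) k.*2 u - euler d k u| <=
  k%:R * (K * d ^+ 2) * (growth d k * `|F u|).
Proof.
move=> d0; have d2 : 0 <= d / 2 by rewrite divr_ge0.
have dbl j : growth (d / 2) j.*2 = growth d j.
  by congr expR; rewrite -muln2 natrM; field.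
elim: k => [|k ih]; first by rewrite subrr normr0 !mul0r.
set v := euler (d / 2) k.*2 u in ih *.
have -> : euler (d / 2) k.+1.*2 u = euler (d / 2) 2 v.
  by rewrite doubleS -add2n eulerD.
have -> : euler d k.+1 u = euler d 1 (euler d k u) by [].
(* The intermediate point is one coarse step from the fine value [v]: this separates the local error
   from the propagation of the earlier error. *)
rewrite (le_trans (ler_distD (euler d 1 v) _ _))//.
have half : `|euler (d / 2) 2 v - euler d 1 v| <=
    K * d ^+ 2 * (growth d k.+1 * `|F u|).
  have := euler_quadratic (d / 2) 2 v d2.
  have -> : 2 * (d / 2) = d by field.
  rewrite -addrA -opprD => /le_trans; apply.
  rewrite ler_wpM2l ?mulr_ge0 ?sqr_ge0// -[k.+1]add1n growthD -mulrA.
  rewrite -[growth (d / 2) 2]/(growth (d / 2) 1.*2) dbl.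
  rewrite ler_wpM2l ?growth_ge0//.
  by rewrite -dbl euler_field_le.
rewrite (le_trans (lerD half (euler_lip _ _ _ _ d0)))//.
rewrite (le_trans (lerD (lexx _) (ler_wpM2l (growth_ge0 _ _) ih)))//.
rewrite le_eqVlt; apply/orP; left; apply/eqP.
by rewrite -[k.+1]add1n growthD natrD; ring.
Qed.

End euler_scheme.

(** * The flow as limit of Euler approximations on dyadic grids *)

Section lipschitz_flow.
Context {R : realType} {V : completeNormedModType R}.
Variables (F : V -> V) (K : R).
Hypotheses (K_ge0 : 0 <= K) (F_lip : forall u v, `|F u - F v| <= K * `|u - v|).
Implicit Types (t s : R) (m k : nat) (u v : V).

Definition mesh m : R := 2^-1 ^+ m.

Definition ticks m t : nat := Num.truncn (t / mesh m).

(** For nonnegative [t], the scheme is read at the last grid point not after [t], without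
    interpolation. *)
Definition euler_approx m t u := euler F (mesh m) (ticks m t) u.

Definition flow t u : V := lim (euler_approx m t u @[m --> \oo]).

Lemma mesh_gt0 m : 0 < mesh m.
Proof. by rewrite exprn_gt0// invr_gt0. Qed.

Lemma cvg_mesh : mesh @ \oo --> 0.
Proof. by apply: cvg_expr; rewrite gtr0_norm// invf_lt1// ltr1n. Qed.

Lemma ticks_itv m t : 0 <= t ->
  (ticks m t)%:R * mesh m <= t < (ticks m t)%:R * mesh m + mesh m.
Proof.
move=> t0; have /truncn_itv : 0 <= t / mesh m by rewrite divr_ge0// ltW// mesh_gt0.
rewrite ler_pdivlMr ?mesh_gt0// ltr_pdivrMr ?mesh_gt0//.
by rewrite -natr1 mulrDl mul1r.
Qed.

Lemma ticksS m t : 0 <= t ->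
  ticks m.+1 t = (ticks m t).*2 \/ ticks m.+1 t = (ticks m t).*2.+1.
Proof.
move=> t0; have /andP[le_t t_lt] := ticks_itv m t t0.
have tm0 : 0 <= t / mesh m.+1 by rewrite divr_ge0// ltW// mesh_gt0.
have ge : ((ticks m t).*2 <= ticks m.+1 t)%N.
  rewrite truncn_ge_nat// ler_pdivlMr ?mesh_gt0// /mesh exprS mulrA.
  by rewrite -muln2 natrM mulfK.
have lt : (ticks m.+1 t < (ticks m t).*2.+2)%N.
  rewrite truncn_lt_nat// ltr_pdivrMr ?mesh_gt0// /mesh exprS mulrA.
  by rewrite -doubleS -muln2 natrM mulfK// -natr1 mulrDl mul1r.
move: lt; rewrite ltnS leq_eqVlt ltnS => /orP[/eqP|le]; first by right.
by left; apply/eqP; rewrite eqn_leq le.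
Qed.

Lemma growth_le d k t : k%:R * d <= t -> growth K d k <= expR (K * t).
Proof. by move=> kt; rewrite ler_expR ler_wpM2l. Qed.

(** Refining the grid costs K t B [mesh m] for halving the steps, with B = exp(K t) |F u|, and at
    most B [mesh m] for the extra half step that the finer grid may fit before [t]. The bound is
    geometric in [m]. *)
Lemma euler_approx_step m t u : 0 <= t ->
  `|euler_approx m.+1 t u - euler_approx m t u| <=
  (K * t + 1) * (expR (K * t) * `|F u|) * mesh m.
Proof.
move=> t0; have /andP[le_t t_lt] := ticks_itv m t t0.
have d0 : 0 <= mesh m by rewrite ltW// mesh_gt0.
have meshS : mesh m.+1 = mesh m / 2 by rewrite /mesh exprS mulrC.
have d20 : 0 <= mesh m / 2 by rewrite divr_ge0.
set p := ticks m t in le_t *; set B := expR (K * t) * `|F u|.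
have B0 : 0 <= B by rewrite mulr_ge0// expR_ge0.
have halve : `|euler F (mesh m / 2) p.*2 u - euler F (mesh m) p u| <=
    K * t * mesh m * B.
  rewrite (le_trans (euler_halve F K K_ge0 F_lip _ _ _ d0))//.
  rewrite (@le_trans _ _ (p%:R * (K * mesh m ^+ 2) * B))//.
    rewrite ler_wpM2l ?mulr_ge0 ?sqr_ge0//.
    by rewrite ler_wpM2r// growth_le.
  rewrite ler_wpM2r//.
  rewrite (_ : p%:R * (K * mesh m ^+ 2) = (K * mesh m) * (p%:R * mesh m)); last by ring.
  by rewrite [leRHS]mulrAC ler_wpM2l ?mulr_ge0.
have last_step : mesh m / 2 * `|F (euler F (mesh m / 2) p.*2 u)| <= mesh m * B.
  apply: ler_pM => //; first by rewrite ler_pdivrMr// ler_peMr// ler1n.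
  rewrite (le_trans (euler_field_le F K F_lip _ _ _ d20))// ler_wpM2r//.
  apply: growth_le; rewrite -muln2 natrM -mulrA (_ : 2 * (mesh m / 2) = mesh m)//.
  by field.
rewrite -/p (_ : (K * t + 1) * B * mesh m = K * t * mesh m * B + mesh m * B); last by ring.
rewrite /euler_approx meshS -/p.
have [->|->] := ticksS m t t0.
  by rewrite (le_trans halve)// lerDl mulr_ge0.
rewrite eulerS addrAC (le_trans (ler_normD _ _))// lerD//.
by rewrite normrZ (ger0_norm d20).
Qed.

Lemma cvg_flow t u : 0 <= t -> euler_approx m t u @[m --> \oo] --> flow t u.
Proof.
move=> t0; suff : cvgn (fun m => euler_approx m t u) by [].
pose w m := euler_approx m t u.
(* Convergence is that of the telescoping series, which is dominated in norm by a geometric one. *)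
rewrite (_ : (fun m => _) = fun m => w 0 + series (telescope w) m); last first.
  by apply/funext => m; rewrite -eq_sum_telescope.
apply: is_cvgD; first exact: is_cvg_cst.
apply: normed_cvg.
apply: (@series_le_cvg _ _
  (geometric ((K * t + 1) * (expR (K * t) * `|F u|)) 2^-1)) => //.
- by move=> m; exact: normr_ge0.
- move=> m; apply: geometric_ge0; rewrite ?invr_ge0// mulr_ge0//.
    by rewrite addr_ge0// mulr_ge0.
- by move=> m; exact: euler_approx_step.
- by apply: is_cvg_geometric_series; rewrite gtr0_norm// invf_lt1// ltr1n.
Qed.

Lemma flow0 u : flow 0 u = u.
Proof.
rewrite /flow (_ : (fun m => _) = fun=> u) ?lim_cst//.
by apply/funext => m; rewrite /euler_approx /ticks mul0r truncn0.
Qed.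

Lemma cvg_ticks t : 0 <= t -> (ticks m t)%:R * mesh m @[m --> \oo] --> t.
Proof.
move=> t0; apply/cvgrPdist_le => e e0.
have /cvgrPdist_le/(_ _ e0) := cvg_mesh; apply: filterS => m /=.
rewrite sub0r normrN (ger0_norm (ltW (mesh_gt0 m))); apply: le_trans.
have /andP[le_t /ltW t_le] := ticks_itv m t t0.
by rewrite ler_distl t_le andbT (le_trans _ le_t)// gerBl ltW// mesh_gt0.
Qed.

Lemma lipschitz_field_continuous : continuous F.
Proof.
move=> u; apply/cvgrPdist_le => e e0.
(* [K] may be zero, so [K + 1] is used as the divisor. *)
have K1 : 0 < K + 1 by rewrite ltr_wpDl.
near=> v; rewrite (le_trans (F_lip _ _))//.
rewrite (@le_trans _ _ ((K + 1) * `|u - v|))//; first by rewrite ler_wpM2r// lerDl.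
rewrite -ler_pdivlMl//; near: v.
by have /cvgrPdist_le := @cvg_id _ (nbhs u); apply; rewrite mulr_gt0// invr_gt0.
Unshelve. all: by end_near. Qed.

Lemma flow_lip t u v : 0 <= t -> `|flow t u - flow t v| <= expR (K * t) * `|u - v|.
Proof.
move=> t0.
have h : `|euler_approx m t u - euler_approx m t v| @[m --> \oo] -->
    `|flow t u - flow t v|.
  exact: cvg_norm (cvgB (cvg_flow _ u t0) (cvg_flow _ v t0)).
apply: (cvgr_to_le h); apply: nearW => m.
rewrite (le_trans (euler_lip F K F_lip _ _ _ _ (ltW (mesh_gt0 m))))//.
by rewrite ler_wpM2r// growth_le//; have /andP[] := ticks_itv m t t0.
Qed.

Lemma flow_field_le t u : 0 <= t -> `|F (flow t u)| <= expR (K * t) * `|F u|.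
Proof.
move=> t0.
have h : `|F (euler_approx m t u)| @[m --> \oo] --> `|F (flow t u)|.
  apply: cvg_norm.
  exact: (cvg_comp _ _ (cvg_flow _ u t0) (lipschitz_field_continuous _)).
apply: (cvgr_to_le h); apply: nearW => m /=.
rewrite (le_trans (euler_field_le F K F_lip _ _ _ (ltW (mesh_gt0 m))))//.
by rewrite ler_wpM2r// growth_le//; have /andP[] := ticks_itv m t t0.
Qed.

(** This is the limit of [euler_quadratic] started at the approximation for time [t]: on a common
    grid the scheme for [s] continues the scheme for [t], and the grid time [r m] between them tends
    to s - t. *)
Lemma flow_quadratic t s u : 0 <= t -> t <= s ->
  `|flow s u - flow t u - (s - t) *: F (flow t u)| <=
  K * (s - t) ^+ 2 * (expR (K * s) * `|F u|).
Proof.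
move=> t0 ts; have s0 := le_trans t0 ts.
pose r m := (ticks m s)%:R * mesh m - (ticks m t)%:R * mesh m.
have cr : r m @[m --> \oo] --> s - t by apply: cvgB; exact: cvg_ticks.
have cF : F (euler_approx m t u) @[m --> \oo] --> F (flow t u).
  exact: (cvg_comp _ _ (cvg_flow _ u t0) (lipschitz_field_continuous _)).
have lhs : `|euler_approx m s u - euler_approx m t u -
    r m *: F (euler_approx m t u)| @[m --> \oo] -->
    `|flow s u - flow t u - (s - t) *: F (flow t u)|.
  exact: cvg_norm (cvgB (cvgB (cvg_flow _ u s0) (cvg_flow _ u t0)) (cvgZ cr cF)).
have rhs : K * (r m * r m) * (expR (K * s) * `|F u|) @[m --> \oo] -->
    K * ((s - t) * (s - t)) * (expR (K * s) * `|F u|).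
  exact: cvgM (cvgM (cvg_cst K) (cvgM cr cr)) (cvg_cst (expR (K * s) * `|F u|)).
rewrite expr2; apply: (ler_cvg_to lhs rhs); apply: nearW => m /=.
have d0 := ltW (mesh_gt0 m).
have le_ticks : (ticks m t <= ticks m s)%N.
  by apply: le_truncn; rewrite ler_wpM2r// invr_ge0.
have rE : r m = (ticks m s - ticks m t)%:R * mesh m by rewrite natrB// mulrBl.
have := euler_quadratic F K K_ge0 F_lip (mesh m) (ticks m s - ticks m t)
  (euler_approx m t u) d0.
rewrite -eulerD subnK// -rE => /le_trans; apply.
rewrite -expr2 ler_wpM2l//; first by rewrite mulr_ge0// sqr_ge0.
rewrite (@le_trans _ _ (growth K (mesh m) (ticks m s - ticks m t) *
    (growth K (mesh m) (ticks m t) * `|F u|)))//.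
  by rewrite ler_wpM2l ?growth_ge0// euler_field_le.
rewrite mulrA -growthD subnK// ler_wpM2r// growth_le//.
by have /andP[] := ticks_itv m s s0.
Qed.

End lipschitz_flow.

(** * One-sided derivatives and a Gronwall argument *)

Section one_sided_ode.
Context {R : realType} {V : normedModType R}.
Implicit Types (w : R -> V) (t e : R).

(** A form free of division, which also covers s = 0. *)
Lemma is_derive_ge0P w t (v : V) :
  is_derive_ge0 w t v <->
  forall e, 0 < e -> exists2 d, 0 < d & forall s, `|s| < d -> 0 <= t + s ->
    `|w (t + s) - w t - s *: v| <= `|s| * e.
Proof.
have quotE s : s != 0 -> `|v - s^-1 *: (w (t + s) - w t)| =
    `|s|^-1 * `|w (t + s) - w t - s *: v|.
  move=> s0; rewrite distrC -normfV -normrZ [in RHS]scalerBr scalerA mulVf//.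
  by rewrite scale1r.
split=> [/cvgrPdist_le wv e e0|wv].
  have /nbhs_ballP[d /= d0 dP] := wv _ e0; exists d => // s sd ts0.
  have [->|s0] := eqVneq s 0.
    by rewrite addr0 subrr scale0r subrr !normr0 mul0r.
  have := dP s; rewrite -ball_normE/= sub0r normrN => /(_ sd s0 ts0).
  by rewrite quotE// ler_pdivrMl// normr_gt0.
apply/cvgrPdist_le => e e0; have [d d0 dP] := wv _ e0.
apply/nbhs_ballP; exists d => //= s; rewrite -ball_normE/= sub0r normrN => sd s0 ts0.
by rewrite quotE// ler_pdivrMl ?normr_gt0// dP.
Qed.

(** The hypothesis is |w'| <= K |w| in difference form, so the norm never has to be
    differentiated. *)
Lemma gronwall_zero w (K : R) : 0 <= K -> w 0 = 0 ->
  (forall t e, 0 <= t -> 0 < e -> exists2 d, 0 < d &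
    forall s, `|s| < d -> 0 <= t + s ->
      `|w (t + s) - w t| <= `|s| * (K * `|w t| + e)) ->
  forall t, 0 <= t -> w t = 0.
Proof.
move=> K0 w0 wK T T0.
have w_le s t : `|w (t + s)| <= `|w t| + `|w (t + s) - w t|.
  by have := ler_normD (w t) (w (t + s) - w t); rewrite [w t + _]addrC subrK.
(* It suffices to bound w by the strict supersolution e exp((K + 1) t), which is
   done by a continuation argument on the largest interval where it holds. *)
suff small e : 0 < e -> `|w T| <= e * expR ((K + 1) * T).
  apply/eqP; rewrite -normr_le0; apply/ler_addgt0Pr => e e0; rewrite add0r.
  have := small (e / expR ((K + 1) * T)); rewrite divr_gt0 ?expR_gt0// => /(_ isT).
  by rewrite divfK// gt_eqF// expR_gt0.
move=> e0; pose psi t := e * expR ((K + 1) * t).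
have psi_ge0 t : 0 <= psi t by rewrite mulr_ge0 ?expR_ge0// ltW.
(* [psi] lies above its tangent lines. *)
have psiD t s : psi t + s * ((K + 1) * psi t) <= psi (t + s).
  have -> : psi (t + s) = psi t * expR ((K + 1) * s).
    by rewrite /psi mulrDr expRD mulrA.
  rewrite (_ : _ + _ = psi t * (1 + (K + 1) * s)); last by ring.
  by rewrite ler_wpM2l ?expR_ge1Dx.
have psi_mono s t : s <= t -> psi s <= psi t.
  move=> st; rewrite /psi ler_wpM2l//; first exact: ltW.
  by rewrite ler_expR ler_wpM2l// addr_ge0.
pose A := [set t | 0 <= t <= T /\ forall s, 0 <= s <= t -> `|w s| <= psi s].
have A0 : A 0.
  split; first by rewrite lexx.
  by move=> s /andP[s0 s1]; rewrite (_ : s = 0) ?w0 ?normr0//; lra.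
have AT : has_ubound A by exists T => t [/andP[_ ?] _].
have supA : has_sup A by split => //; exists 0.
set tau := sup A.
have tau0 : 0 <= tau by exact: ub_le_sup.
have tauT : tau <= T by apply: ge_sup; [exists 0|move=> t [/andP[_ ?] _]].
have below s : 0 <= s -> s < tau -> `|w s| <= psi s.
  move=> s0; rewrite -subr_gt0 => /sup_adherent/(_ supA)[t [_ At]].
  by rewrite -/tau opprB addrC subrK => st; apply: At; rewrite s0 ltW.
(* The bound reaches [tau] from the left: a backward step of length [s] stays in the domain and
   changes [w] by at most [r]. *)
have at_tau : `|w tau| <= psi tau.
  apply/ler_addgt0Pr => r r0.
  have [d d0 dP] := wK tau 1 tau0 ltr01.
  have [tau_gt0|tau_le0] := ltP 0 tau; last first.
    rewrite (_ : tau = 0); last by apply/eqP; rewrite eq_le tau_le0.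
    by rewrite w0 normr0 addr_ge0// ltW.
  pose C := K * `|w tau| + 1.
  have C0 : 0 < C by rewrite ltr_wpDl ?mulr_ge0.
  pose s := Num.min (d / 2) (Num.min tau (r / C)).
  have s0 : 0 < s by rewrite !lt_min divr_gt0// tau_gt0 divr_gt0.
  have sd : s < d by rewrite (@le_lt_trans _ _ (d / 2)) ?ge_min ?lexx// ltr_pdivrMr// mulr_natr mulr2n ltrDl.
  have stau : s <= tau by rewrite !ge_min lexx orbT.
  have sr : s * C <= r by rewrite -ler_pdivlMr// !ge_min lexx !orbT.
  have := dP (- s); rewrite normrN (gtr0_norm s0) subr_ge0 => /(_ sd stau) wtau.
  have wlow : `|w (tau - s)| <= psi (tau - s) by apply: below; lra.
  have : `|w tau| <= `|w (tau - s)| + `|w (tau - s) - w tau|.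
    by have := w_le s (tau - s); rewrite subrK (distrC (w tau)).
  have : psi (tau - s) <= psi tau by apply: psi_mono; lra.
  move: wtau sr; rewrite -/C; lra.
have Atau : A tau.
  split; first by rewrite tau0.
  move=> s /andP[s0]; rewrite le_eqVlt => /orP[/eqP->//|]; exact: below.
have [tT|] := ltP tau T; last first.
  move=> Ttau; have <- : tau = T by apply/eqP; rewrite eq_le tauT.
  exact: at_tau.
(* If [tau] were below [T], the bound would extend past it. The tolerance [e] is at most [psi tau],
   so the slope K |w| + e stays below (K + 1) [psi tau]; this is why the exponent has K + 1. *)
have [d d0 dP] := wK tau e tau0 e0.
pose s := Num.min (d / 2) (T - tau).
have s0 : 0 < s by rewrite lt_min divr_gt0// subr_gt0.
have sd : s < d by rewrite (@le_lt_trans _ _ (d / 2)) ?ge_min ?lexx// ltr_pdivrMr// mulr_natr mulr2n ltrDl.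
have sT : s <= T - tau by rewrite ge_min lexx orbT.
have : A (tau + s).
  split; first by rewrite addr_ge0 ?(ltW s0)//=; lra.
  move=> r /andP[r0 rs]; have [rtau|taur] := leP r tau.
    by apply: Atau.2; rewrite r0.
  have r'0 : 0 <= r - tau by lra.
  have rE : tau + (r - tau) = r by ring.
  have := dP (r - tau); rewrite (ger0_norm r'0) rE => /(_ _ r0) h.
  have {}h : `|w r - w tau| <= (r - tau) * (K * `|w tau| + e) by apply: h; lra.
  have := w_le (r - tau) tau; rewrite rE => /le_trans; apply.
  have := psiD tau (r - tau); rewrite rE; apply: le_trans.
  apply: lerD => //; rewrite (le_trans h)// ler_wpM2l// mulrDl mul1r.
  apply: lerD; first by rewrite ler_wpM2l.
  rewrite /psi ler_peMr ?(ltW e0)// -[leLHS]expR0 ler_expR mulr_ge0//.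
  by rewrite addr_ge0.
by move=> /(ub_le_sup AT); rewrite -/tau gerDl leNgt s0.
Qed.

End one_sided_ode.

(** * Uniqueness, existence and continuous dependence *)

Section lipschitz_well_posed.
Context {R : realType} {V : completeNormedModType R}.
Variables (F : V -> V) (K : R).
Hypotheses (K_ge0 : 0 <= K) (F_lip : forall u v, `|F u - F v| <= K * `|u - v|).

Lemma C1_solution_unique (u v : R -> V) (u0 : V) :
  is_C1_solution F u0 u -> is_C1_solution F u0 v ->
  forall t, 0 <= t -> u t = v t.
Proof.
move=> [u' [u_0 du _ u'E]] [v' [v_0 dv _ v'E]] t t0.
apply/eqP; rewrite -subr_eq0; apply/eqP; move: t t0.
apply: (@gronwall_zero _ _ (fun t => u t - v t) K K_ge0).
  by rewrite u_0 v_0 subrr.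
move=> t e t0 e0; have e2 : 0 < e / 2 by rewrite divr_gt0.
have [a a0 aP] := (is_derive_ge0P _ _ _).1 (du _ t0) _ e2.
have [b b0 bP] := (is_derive_ge0P _ _ _).1 (dv _ t0) _ e2.
exists (Num.min a b); first by rewrite lt_min a0.
move=> s; rewrite lt_min => /andP[sa sb] ts0.
have := aP _ sa ts0; have := bP _ sb ts0.
rewrite u'E// v'E//; set B := v (t + s) - _ - _; set A := u (t + s) - _ - _.
move=> Be Ae.
have -> : u (t + s) - v (t + s) - (u t - v t) =
    A - B + s *: (F (u t) - F (v t)).
  have cancel_slopes (p q x y : V) : p - x - (q - y) + (x - y) = p - q.
    by rewrite opprB addrAC !addrA !subrK.
  by rewrite scalerBr /A /B cancel_slopes !opprD !opprK addrACA.
rewrite (le_trans (ler_normD _ _))// normrZ mulrDr addrC lerD//.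
  by rewrite ler_wpM2l.
rewrite (le_trans (ler_normB _ _))// (le_trans (lerD Ae Be))//.
by rewrite -mulrDr -splitr.
Qed.

(** For b < a the forward estimate from [b] to [a] is reversed, and replacing the slope at [b] by
    the slope at [a] costs K (a - b) times the distance of the two points. *)
Lemma flow_quadratic_two_sided (T : R) u : 0 <= T ->
  exists2 C, 0 <= C & forall a b, 0 <= a <= T -> 0 <= b <= T ->
    `|flow F b u - flow F a u - (b - a) *: F (flow F a u)| <= C * (b - a) ^+ 2.
Proof.
move=> T0; pose B := expR (K * T) * `|F u|.
have B0 : 0 <= B by rewrite mulr_ge0 ?expR_ge0.
(* K B comes from the forward estimate and K B (K T + 1) from the exchange of slopes. *)
exists (K * B * (K * T + 2)); first by rewrite !mulr_ge0// addr_ge0 ?mulr_ge0.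
have forw a b : 0 <= a -> a <= b -> b <= T ->
    `|flow F b u - flow F a u - (b - a) *: F (flow F a u)| <= K * B * (b - a) ^+ 2.
  move=> a0 ab bT; rewrite (le_trans (flow_quadratic F K K_ge0 F_lip _ _ u a0 ab))//.
  rewrite mulrAC ler_wpM2r ?sqr_ge0// ler_wpM2l// ler_wpM2r//.
  by rewrite ler_expR ler_wpM2l.
move=> a b /andP[a0 aT] /andP[b0 bT]; have [ab|/ltW ba] := leP a b.
  rewrite (le_trans (forw _ _ a0 ab bT))// ler_wpM2r ?sqr_ge0//.
  by rewrite ler_peMr ?mulr_ge0//; have := mulr_ge0 K_ge0 T0; lra.
have h := forw _ _ b0 ba aT.
have r0 : 0 <= a - b by rewrite subr_ge0.
have dist : `|flow F a u - flow F b u| <= (a - b) * ((K * T + 1) * B).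
  rewrite -[X in `|X|](subrK ((a - b) *: F (flow F b u))).
  rewrite (le_trans (ler_normD _ _))// (le_trans (lerD h (lexx _)))//.
  rewrite normrZ (ger0_norm r0).
  have FB : `|F (flow F b u)| <= B.
    rewrite (le_trans (flow_field_le F K K_ge0 F_lip _ u b0))// ler_wpM2r//.
    by rewrite ler_expR ler_wpM2l.
  rewrite (le_trans (lerD (lexx _) (ler_wpM2l r0 FB)))//.
  rewrite (_ : _ + _ = (a - b) * ((K * (a - b) + 1) * B)); last by ring.
  by rewrite !(ler_wpM2l, ler_wpM2r)// lerD2r ler_wpM2l//; lra.
have -> : flow F b u - flow F a u - (b - a) *: F (flow F a u) =
   - (flow F a u - flow F b u - (a - b) *: F (flow F b u)) +
   (a - b) *: (F (flow F a u) - F (flow F b u)).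
  have swap_slopes (p q x y : V) : q - p + x = - (p - q - y) + (x - y).
    by rewrite !opprB [RHS]addrAC [y + _]addrC subrK addrC.
  by rewrite -[b - a]opprB scaleNr opprK scalerBr -swap_slopes.
rewrite (le_trans (ler_normD _ _))// normrN normrZ (ger0_norm r0).
have := F_lip (flow F a u) (flow F b u) => /le_trans/(_ (ler_wpM2l K_ge0 dist)).
move=> /(ler_wpM2l r0) => h2; rewrite (le_trans (lerD h h2))//.
by rewrite le_eqVlt; apply/orP; left; apply/eqP; ring.
Qed.

Lemma flow_C1_solution u0 : is_C1_solution F u0 (flow F ^~ u0).
Proof.
exists (fun t => F (flow F t u0)); split => //.
- exact: flow0.
- move=> t t0; apply/is_derive_ge0P => e e0.
  (* The horizon t + 1 leaves room to the right of [t]; the radius e / (C + 1) then turns C s^2 into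
     at most |s| e. *)
  have [|C C0 CP] := flow_quadratic_two_sided (t + 1) u0; first by rewrite addr_ge0.
  have C1 : 0 < C + 1 by rewrite ltr_wpDl.
  exists (Num.min 1 (e / (C + 1))); first by rewrite lt_min ltr01 divr_gt0.
  move=> s; rewrite lt_min ltr_norml => /andP[/andP[_ s1] sC] ts0.
  have := CP t (t + s); rewrite t0 ts0 !lerD2l lerDl ler01 (ltW s1) => /(_ isT isT).
  rewrite [t + s - t]addrAC subrr add0r => /le_trans; apply.
  rewrite -(real_normK (num_real s)) expr2 mulrCA ler_wpM2l//.
  move: sC; rewrite ltr_pdivlMr// => /ltW; apply: le_trans.
  by rewrite mulrC ler_wpM2l// lerDl.
- apply/subspace_continuousP => t; rewrite /= in_itv/= andbT => t0.
  have cFlow : flow F ^~ u0 @ within `[0, +oo[ (nbhs t) --> flow F t u0.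
    have [|C C0 CP] := flow_quadratic_two_sided (t + 1) u0; first by rewrite addr_ge0.
    pose D := C + `|F (flow F t u0)|.
    have D1 : 0 < D + 1 by rewrite ltr_wpDl ?addr_ge0.
    apply/cvgrPdist_le => e e0; apply/nbhs_ballP.
    exists (Num.min 1 (e / (D + 1))); first by rewrite /= lt_min ltr01 divr_gt0.
    move=> s /=; rewrite -ball_normE/= distrC lt_min => /andP[st1 ste].
    rewrite in_itv/= andbT => s0.
    have sT : s <= t + 1 by move: st1; rewrite ltr_norml => /andP[_]; lra.
    have := CP t s; rewrite t0 s0 sT lerDl ler01 => /(_ isT isT) quad.
    rewrite distrC -[X in `|X|](subrK ((s - t) *: F (flow F t u0))).
    rewrite (le_trans (ler_normD _ _))// (le_trans (lerD quad (lexx _)))//.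
    rewrite normrZ -(real_normK (num_real (s - t))).
    move: ste; rewrite ltr_pdivlMr// => /ltW; apply: le_trans.
    rewrite expr2 mulrCA -mulrDr ler_wpM2l// /D -addrA lerD//.
      by rewrite ler_piMr// ltW.
    by rewrite lerDl.
  exact: (cvg_comp _ _ cFlow (lipschitz_field_continuous F K K_ge0 F_lip _)).
Qed.

Lemma lipschitz_globally_well_posed : globally_well_posed F.
Proof.
exists (flow F); split.
- exact: flow_C1_solution.
- move=> u0 u uS t t0.
  exact: C1_solution_unique uS (flow_C1_solution u0) _ t0.
- move=> t t0 u; apply/cvgrPdist_le => e e0; near=> v.
  rewrite (le_trans (flow_lip F K K_ge0 F_lip _ _ _ t0))//.
  rewrite -ler_pdivlMl ?expR_gt0//; near: v.
  have /cvgrPdist_le := @cvg_id _ (nbhs u); apply.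
  by rewrite mulr_gt0// invr_gt0 expR_gt0.
Unshelve. all: by end_near. Qed.

End lipschitz_well_posed.

(** * The nonlocal equation *)

(** The predicate [lipschitz] asks for the bound for all large constants; one nonnegative constant
    is extracted. *)
Lemma lipschitzP {R : realType} {f : R -> R} : lipschitz f ->
  exists2 L : R, 0 <= L & forall a b, `|f a - f b| <= L * `|a - b|.
Proof.
move=> /pinfty_ex_gt0[L L0 fL]; exists L => [|a b]; first exact: ltW.
exact: (fL (a, b)).
Qed.

Lemma bounded_funP {R : realType} {T : Type} {g : T -> R} : bounded_fun g ->
  exists2 M : R, 0 <= M & forall x, `|g x| <= M.
Proof.
move=> /pinfty_ex_gt0[M M0 gM]; exists M => [|x]; first exact: ltW.
exact: gM.
Qed.

Section nonlocal_field.
Context {R : realType} {n : nat}.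
Local Notation T := 'rV[R]_n.+1.
Local Notation mu := (lebesgue_measure_rV R n).
Variables (J rho h : T -> R) (f : R -> R) (M L Mh : R).
Hypotheses (J_ge0 : forall x, 0 <= J x)
  (J_int : mu.-integrable setT (EFin \o J)).
Hypotheses (rho_cont : continuous rho) (rho_gt0 : forall x, 0 < rho x)
  (rho_le : forall x, `|rho x| <= M).
Hypotheses (h_cont : continuous h) (h_le : forall x, `|h x| <= Mh).
Hypotheses (L_ge0 : 0 <= L) (f_lip : forall a b, `|f a - f b| <= L * `|a - b|).
Local Notation C_rho := (weighted_space rho_gt0).
Implicit Types u v : C_rho.

(** Attaching the weight to the nonlinearity leaves a plain convolution of [J] with a bounded
    continuous function. *)
Let weighted u y := f (u y) * rho y.

Lemma in_weighted_space_bounded (k : T -> R) N :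
  continuous k -> (forall x, `|k x| <= N) -> k \in in_weighted_space rho_gt0.
Proof.
move=> ck kN; apply/asboolP; split => //; exists (N * M) => _ [x _ <-].
by rewrite ler_pM ?(ltW (rho_gt0 x))// (le_trans (ler_norm _) (rho_le x)).
Qed.

Lemma weighted_nonlinearity_continuous u : continuous (weighted u).
Proof.
move=> x; suff: (fun y : T => f (u y) * rho y) @ x --> f (u x) * rho x by [].
have cf : continuous (f : R^o -> R^o).
  (* [f] is treated as a Lipschitz field on the line. *)
  exact: (lipschitz_field_continuous f L L_ge0 f_lip).
have cfu : (fun y : T => f (u y)) @ x --> f (u x).
  exact: (@continuous_comp _ _ _ (u : T -> R) f x (continuous_weighted rho_gt0 u x) (cf (u x))).
exact: (cvgM cfu (rho_cont x)).
Qed.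

Lemma weighted_nonlinearity_le u x : `|weighted u x| <= `|f 0| * M + L * `|u|.
Proof.
rewrite normrM (gtr0_norm (rho_gt0 x)).
have fu : `|f (u x)| <= `|f 0| + L * `|u x|.
  by rewrite -[f (u x)](subrK (f 0)) addrC (le_trans (ler_normD _ _))// lerD//
    (le_trans (f_lip _ _))// subr0.
rewrite (le_trans (ler_wpM2r (ltW (rho_gt0 x)) fu))// mulrDl lerD//.
  by rewrite ler_wpM2l// (le_trans (ler_norm _) (rho_le x)).
by rewrite -mulrA ler_wpM2l// weighted_norm_ub.
Qed.

Lemma weighted_nonlinearity_lip u v x :
  `|weighted u x - weighted v x| <= L * `|u - v|.
Proof.
rewrite -mulrBl normrM (gtr0_norm (rho_gt0 x)).
rewrite (le_trans (ler_wpM2r (ltW (rho_gt0 x)) (f_lip _ _)))//.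
rewrite -mulrA ler_wpM2l//.
exact: (weighted_norm_ub (u - v) x).
Qed.

Lemma wconv_integrandE u x :
  wconv_integrand J rho (f \o u) x = fun y => J (x - y) * weighted u y.
Proof. by apply/funext => y; rewrite /wconv_integrand mulrA. Qed.

Lemma wconv_integrable u x : mu.-integrable setT
  (EFin \o wconv_integrand J rho (f \o u) x).
Proof.
rewrite wconv_integrandE.
exact: (convolution_integrable _ _ _ J_int (weighted_nonlinearity_continuous u)
  (weighted_nonlinearity_le u)).
Qed.

Lemma wconv_in_weighted_space u :
  wconv J rho (f \o u) \in in_weighted_space rho_gt0.
Proof.
have -> : wconv J rho (f \o u) = fun x => \int[mu]_y (J (x - y) * weighted u y).
  by apply/funext => x; rewrite /wconv wconv_integrandE.
apply: in_weighted_space_bounded.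
  exact: (convolution_continuous _ _ _ J_ge0 J_int
    (weighted_nonlinearity_continuous u) (weighted_nonlinearity_le u)).
exact: (convolution_le _ _ _ J_ge0 J_int
    (weighted_nonlinearity_continuous u) (weighted_nonlinearity_le u)).
Qed.

Definition nonlocal_field u : C_rho :=
  - u + WeightedSpace (wconv_in_weighted_space u)
  + WeightedSpace (in_weighted_space_bounded _ _ h_cont h_le).

Lemma nonlocal_fieldE u x :
  nonlocal_field u x = - u x + wconv J rho (f \o u) x + h x.
Proof. by []. Qed.

Lemma wconv_lip u v x : `|wconv J rho (f \o u) x - wconv J rho (f \o v) x| <=
  L * `|u - v| * \int[mu]_y J y.
Proof.
rewrite /wconv -RintegralB//; [|exact: wconv_integrable..].
pose g y := weighted u y - weighted v y.
have -> : (fun y => wconv_integrand J rho (f \o u) x y -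
    wconv_integrand J rho (f \o v) x y) = fun y => J (x - y) * g y.
  by apply/funext => y; rewrite !wconv_integrandE -mulrBr.
apply: (convolution_le _ _ _ J_ge0 J_int).
  move=> y; exact: (cvgB (weighted_nonlinearity_continuous u y)
    (weighted_nonlinearity_continuous v y)).
by move=> y; exact: weighted_nonlinearity_lip.
Qed.

(** The term -u contributes 1; the convolution contributes L times the integral of [J] in the sup
    norm, and the bound [M] of the weight passes to the weighted norm. The term [h] cancels. *)
Lemma nonlocal_field_lip u v :
  `|nonlocal_field u - nonlocal_field v| <=
  (1 + L * (\int[mu]_y J y) * M) * `|u - v|.
Proof.
rewrite /nonlocal_field opprD addrACA subrr addr0 opprD addrACA.
rewrite (le_trans (ler_normD _ _))// mulrDl mul1r -opprD normrN lerD//.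
apply: weighted_norm_le => x.
rewrite (@le_trans _ _ (L * `|u - v| * (\int[mu]_y J y) * M))//; last first.
  by rewrite le_eqVlt; apply/orP; left; apply/eqP; ring.
apply: ler_pM => //; [exact: ltW|exact: wconv_lip|].
by rewrite (le_trans (ler_norm _) (rho_le x)).
Qed.

End nonlocal_field.

Theorem theorem3p3 (R : realType) (n : nat)
    (J rho h : 'rV[R]_n.+1 -> R) (f : R -> R)
    (J_ge0 : forall x, 0 <= J x)
    (J_int : (lebesgue_measure_rV R n).-integrable setT (EFin \o J))
    (rho_sym : forall x, rho (- x) = rho x)
    (rho_cont : continuous rho)
    (rho_gt0 : forall x, 0 < rho x)
    (rho_bounded : bounded_fun rho)
    (rho_int : (lebesgue_measure_rV R n).-integrable setT (EFin \o rho))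
    (h_bounded : bounded_fun h)
    (h_cont : continuous h)
    (f_lip : lipschitz f) :
  exists F : weighted_space rho_gt0 -> weighted_space rho_gt0,
    (forall (u : weighted_space rho_gt0) x,
       (lebesgue_measure_rV R n).-integrable setT
         (EFin \o wconv_integrand J rho (f \o u) x) /\
       F u x = - u x + wconv J rho (f \o u) x + h x) /\
    globally_well_posed F.
Proof.
have [L L0 fL] := lipschitzP f_lip.
have [M M0 rhoM] := bounded_funP rho_bounded.
have [Mh _ hMh] := bounded_funP h_bounded.
exists (nonlocal_field J rho h f M L Mh J_ge0 J_int rho_cont rho_gt0 rhoM
  h_cont hMh L0 fL); split.
  move=> u x; split; last exact: nonlocal_fieldE.
  exact: (wconv_integrable J rho f M L J_int rho_cont rho_gt0 rhoM L0 fL).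
(* Completeness rests on continuity of the weight, which is not a parameter of the type, so the
   structure is assembled here. *)
pose V : completeNormedModType R := HB.pack (weighted_space rho_gt0)
  (Uniform_isComplete.Build _ (weighted_space_complete rho_gt0 rho_cont)).
apply: (@lipschitz_globally_well_posed R V); last exact: nonlocal_field_lip.
by rewrite addr_ge0// !mulr_ge0// Rintegral_ge0.
Qed.
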